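(* Let $\Phi$ be a context, $e$ an evidence term and $F$ a formula such that $\Phi \vdash e : F$ is derivable in the type system below. Then $e$ is terminating with respect to weak head reduction, i.e. there is no infinite weak head reduction sequence starting from $e$.
   Context: Terms $t ::= x \mid K \mid t\,t'$; atomic formulas $A ::= P\,t_1\cdots t_n$. Formulas: $F ::= A \mid \forall x.F \mid F \Rightarrow F'$. Evidence: $e ::= \kappa \mid \alpha \mid \lambda\alpha.e \mid e\,e' \mid \mu\alpha.e$ ($\kappa$ constants, $\alpha$ variables). Contexts: $\Phi ::= \cdot \mid e : F, \Phi$. Let $a$ range over constants $\kappa$ and variables $\alpha$. A term $e$ is in head normal form, $\mathrm{HNF}(e)$, if $e = \lambda\alpha_1\cdots\lambda\alpha_k.\,\kappa\,e_1\cdots e_l$ ($k,l\ge 0$). Typing rules: (Assump) if $(a : F) \in \Phi$ then $\Phi \vdash a : F$; (App) if $\Phi \vdash e_1 : F'$ and $\Phi \vdash e_2 : F' \Rightarrow F$ then $\Phi \vdash e_2\,e_1 : F$; (Abs) if $\Phi, \alpha : F' \vdash e : F$ then $\Phi \vdash \lambda\alpha.e : F' \Rightarrow F$; (Gen) if $\Phi \vdash e : F$ and $x \notin \mathrm{FV}(\Phi)$ then $\Phi \vdash e : \forall x.F$; (Inst) if $\Phi \vdash e : \forall x.F$ then $\Phi \vdash e : [t/x]F$; (Mu) if $\Phi, \alpha : F \vdash e : F$ and $\mathrm{HNF}(e)$ then $\Phi \vdash \mu\alpha.e : F$. Weak head reduction contexts: $\mathcal{C} ::= \bullet \mid \mathcal{C}\,e$.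 Weak head reduction: $\mathcal{C}[\mu\alpha.e] \leadsto \mathcal{C}[[\mu\alpha.e/\alpha]e]$ and $\mathcal{C}[(\lambda\alpha.e)\,e'] \leadsto \mathcal{C}[[e'/\alpha]e]$. *)

(* Defs.v *)
(* Expressions are taken up to alpha-equivalence, by de Bruijn indices: one
   index space for first-order variables (bound by [All]) and a separate one
   for evidence variables (bound by [ELam] and [EMu]).  Indices pointing past
   all enclosing binders are the free variables. *)
From Stdlib Require Import List.

Inductive term (K : Type) : Type :=
| TVar (x : nat)
| TConst (k : K)
| TApp (t t' : term K).

Arguments TVar {K} x.
Arguments TConst {K} k.
Arguments TApp {K} t t'.

Inductive formula (K P : Type) : Type :=
| Atom (p : P) (ts : list (term K))
| All (F : formula K P)
| Imp (F F' : formula K P).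

Arguments Atom {K P} p ts.
Arguments All {K P} F.
Arguments Imp {K P} F F'.

Inductive evidence (C : Type) : Type :=
| EConst (k : C)
| EVar (a : nat)
| ELam (e : evidence C)
| EApp (e e' : evidence C)
| EMu (e : evidence C).

Arguments EConst {C} k.
Arguments EVar {C} a.
Arguments ELam {C} e.
Arguments EApp {C} e e'.
Arguments EMu {C} e.

Definition scons {X : Type} (x : X) (s : nat -> X) (n : nat) : X :=
  match n with 0 => x | S m => s m end.

Fixpoint tsubst {K : Type} (s : nat -> term K) (t : term K) : term K :=
  match t with
  | TVar x => s x
  | TConst k => TConst k
  | TApp t1 t2 => TApp (tsubst s t1) (tsubst s t2)
  end.

Definition tshift {K : Type} : term K -> term K :=
  tsubst (fun x => TVar (S x)).

Fixpoint fsubst {K P : Type} (s : nat -> term K) (F : formula K P)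
  : formula K P :=
  match F with
  | Atom p ts => Atom p (map (tsubst s) ts)
  | All F1 => All (fsubst (scons (TVar 0) (fun x => tshift (s x))) F1)
  | Imp F1 F2 => Imp (fsubst s F1) (fsubst s F2)
  end.

Definition fshift {K P : Type} : formula K P -> formula K P :=
  fsubst (fun x => TVar (S x)).

(* [t/x]F, where x is the variable bound by the quantifier of [All F]. *)
Definition finst {K P : Type} (t : term K) (F : formula K P) : formula K P :=
  fsubst (scons t (@TVar K)) F.

Fixpoint eren {C : Type} (r : nat -> nat) (e : evidence C) : evidence C :=
  match e with
  | EConst k => EConst k
  | EVar a => EVar (r a)
  | ELam e1 => ELam (eren (scons 0 (fun a => S (r a))) e1)
  | EApp e1 e2 => EApp (eren r e1) (eren r e2)
  | EMu e1 => EMu (eren (scons 0 (fun a => S (r a))) e1)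
  end.

Definition eshift {C : Type} : evidence C -> evidence C := eren S.

Fixpoint esubst {C : Type} (s : nat -> evidence C) (e : evidence C)
  : evidence C :=
  match e with
  | EConst k => EConst k
  | EVar a => s a
  | ELam e1 => ELam (esubst (scons (EVar 0) (fun a => eshift (s a))) e1)
  | EApp e1 e2 => EApp (esubst s e1) (esubst s e2)
  | EMu e1 => EMu (esubst (scons (EVar 0) (fun a => eshift (s a))) e1)
  end.

(* [e'/alpha]e, where alpha is the variable bound by [ELam e] or [EMu e]. *)
Definition einst {C : Type} (e' e : evidence C) : evidence C :=
  esubst (scons e' (@EVar C)) e.

Definition elams {C : Type} (k : nat) (e : evidence C) : evidence C :=
  Nat.iter k (@ELam C) e.

Definition eapps {C : Type} (e : evidence C) (es : list (evidence C))
  : evidence C :=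
  fold_left (@EApp C) es e.

Definition HNF {C : Type} (e : evidence C) : Prop :=
  exists (k : nat) (c : C) (es : list (evidence C)),
    e = elams k (eapps (EConst c) es).

(* As in the grammar of contexts, an entry may assign a formula to any
   evidence, and the same evidence may occur in several entries. *)
Definition ctx (K P C : Type) : Type := list (evidence C * formula K P).

(* The context "Phi, alpha : F" under a binder of the evidence variable alpha.
   Shifting the evidence of Phi makes alpha (index 0) fresh for Phi. *)
Definition ctx_ext {K P C : Type} (Phi : ctx K P C) (F : formula K P)
  : ctx K P C :=
  (EVar 0, F) :: map (fun d => (eshift (fst d), snd d)) Phi.

(* Phi with its first-order variables renamed so that index 0 is not free in
   it; this renders the side condition "x not in FV(Phi)" of the
   generalisation rule. *)
Definition ctx_fshift {K P C : Type} (Phi : ctx K P C) : ctx K P C :=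
  map (fun d => (fst d, fshift (snd d))) Phi.

Inductive typing {K P C : Type}
  : ctx K P C -> evidence C -> formula K P -> Prop :=
| ty_const Phi c F :
    In (EConst c, F) Phi -> typing Phi (EConst c) F
| ty_var Phi a F :
    In (EVar a, F) Phi -> typing Phi (EVar a) F
| ty_app Phi e1 e2 F' F :
    typing Phi e1 F' -> typing Phi e2 (Imp F' F) -> typing Phi (EApp e2 e1) F
| ty_abs Phi e F' F :
    typing (ctx_ext Phi F') e F -> typing Phi (ELam e) (Imp F' F)
| ty_gen Phi e F :
    typing (ctx_fshift Phi) e F -> typing Phi e (All F)
| ty_inst Phi e F t :
    typing Phi e (All F) -> typing Phi e (finst t F)
| ty_mu Phi e F :
    typing (ctx_ext Phi F) e F -> HNF e -> typing Phi (EMu e) F.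

Inductive rctx (C : Type) : Type :=
| Hole
| RApp (R : rctx C) (e : evidence C).

Arguments Hole {C}.
Arguments RApp {C} R e.

Fixpoint plug {C : Type} (R : rctx C) (e : evidence C) : evidence C :=
  match R with
  | Hole => e
  | RApp R' e' => EApp (plug R' e) e'
  end.

Inductive whred {C : Type} : evidence C -> evidence C -> Prop :=
| wh_mu R e :
    whred (plug R (EMu e)) (plug R (einst (EMu e) e))
| wh_beta R e e' :
    whred (plug R (EApp (ELam e) e')) (plug R (einst e' e)).

Definition wh_terminating {C : Type} (e : evidence C) : Prop :=
  ~ exists s : nat -> evidence C,
      s 0 = e /\ forall n : nat, whred (s n) (s (S n)).

(* Main.v *)
(* Reducibility argument.  Formulas are read as simple types: quantifiers are
   ignored, atoms denote the weakly head terminating terms and implication the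
   function space.  Every reducible term terminates, every term that terminates
   under all lists of arguments is reducible at every formula, and reducibility
   is closed under head expansion.  The rule for [mu] needs no induction on
   unfoldings: the body is a head normal form, so once enough arguments are
   supplied its unfolding reaches a constant applied to terms, whatever these
   are; hence it terminates under all lists of arguments. *)
Require Import Defs.
From Stdlib Require Import List.

(** * Substitution calculus for evidence *)

Section Substitution.

Context {C : Type}.
Implicit Types (e : evidence C) (r : nat -> nat) (s t : nat -> evidence C).

Definition up s : nat -> evidence C := scons (EVar 0) (fun a => eshift (s a)).

Lemma eren_ext e : forall r r', (forall a, r a = r' a) -> eren r e = eren r' e.
Proof.
  induction e as [c|a|e IH|e1 IH1 e2 IH2|e IH]; simpl; intros r r' H; f_equal;
    auto; apply IH; intros [|a]; simpl; congruence.
Qed.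

Lemma esubst_ext e : forall s t,
  (forall a, s a = t a) -> esubst s e = esubst t e.
Proof.
  induction e as [c|a|e IH|e1 IH1 e2 IH2|e IH]; simpl; intros s t H; f_equal;
    auto; apply IH; intros [|a]; simpl; congruence.
Qed.

Lemma esubst_id e : forall s, (forall a, s a = EVar a) -> esubst s e = e.
Proof.
  induction e as [c|a|e IH|e1 IH1 e2 IH2|e IH]; simpl; intros s H; f_equal;
    auto; apply IH; intros [|a]; simpl; auto; now rewrite H.
Qed.

Lemma eren_eren e : forall r r',
  eren r' (eren r e) = eren (fun a => r' (r a)) e.
Proof.
  induction e as [c|a|e IH|e1 IH1 e2 IH2|e IH]; simpl; intros r r'; f_equal;
    auto; rewrite IH; apply eren_ext; now intros [|a].
Qed.

Lemma esubst_eren e : forall r t,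
  esubst t (eren r e) = esubst (fun a => t (r a)) e.
Proof.
  induction e as [c|a|e IH|e1 IH1 e2 IH2|e IH]; simpl; intros r t; f_equal;
    auto; rewrite IH; apply esubst_ext; now intros [|a].
Qed.

Lemma eren_esubst e : forall s r,
  eren r (esubst s e) = esubst (fun a => eren r (s a)) e.
Proof.
  induction e as [c|a|e IH|e1 IH1 e2 IH2|e IH]; simpl; intros s r; f_equal;
    auto; rewrite IH; apply esubst_ext; intros [|a]; simpl; auto;
    unfold eshift; now rewrite !eren_eren.
Qed.

Lemma esubst_esubst e : forall s t,
  esubst t (esubst s e) = esubst (fun a => esubst t (s a)) e.
Proof.
  induction e as [c|a|e IH|e1 IH1 e2 IH2|e IH]; simpl; intros s t; f_equal;
    auto; rewrite IH; apply esubst_ext; intros [|a]; simpl; auto;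
    unfold eshift; now rewrite esubst_eren, eren_esubst.
Qed.

Lemma einst_esubst_up x s e :
  einst x (esubst (up s) e) = esubst (scons x s) e.
Proof.
  unfold einst; rewrite esubst_esubst; apply esubst_ext; intros [|a]; simpl;
    auto.
  unfold eshift; rewrite esubst_eren; now apply esubst_id.
Qed.

Lemma esubst_eapps s es : forall e,
  esubst s (eapps e es) = eapps (esubst s e) (map (esubst s) es).
Proof. induction es as [|x es IH]; intros e; [easy|apply (IH (EApp e x))]. Qed.

(** The head is a constant, so substitution reaches only the arguments. Keeping [k] and [c] explicit
    allows the later induction on the number of abstractions. *)
Lemma esubst_const_hnf c es k : forall s, exists es',
  esubst s (elams k (eapps (EConst c) es)) = elams k (eapps (EConst c) es').
Proof.
  induction k as [|k IH]; intros s.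
  - exists (map (esubst s) es); apply esubst_eapps.
  - destruct (IH (up s)) as [es' H]; exists es'; simpl.
    now f_equal.
Qed.

Lemma HNF_esubst s e : HNF e -> HNF (esubst s e).
Proof.
  intros (k & c & es & ->).
  destruct (esubst_const_hnf c es k s) as [es' ->]; now exists k, c, es'.
Qed.

End Substitution.

(** * Weak head reduction and termination under arguments *)

Section Termination.

Context {C : Type}.
Implicit Types (e : evidence C).

Lemma whred_app e1 e2 x : whred e1 e2 -> whred (EApp e1 x) (EApp e2 x).
Proof.
  intros [R e|R e e'].
  - exact (wh_mu (RApp R x) e).
  - exact (wh_beta (RApp R x) e e').
Qed.

Lemma whred_eapps es : forall e1 e2,
  whred e1 e2 -> whred (eapps e1 es) (eapps e2 es).
Proof.
  induction es as [|x es IH]; intros e1 e2 H; [easy|].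
  now apply IH, whred_app.
Qed.

Lemma whred_inv e e' : whred e e' ->
  match e with
  | EApp e1 x =>
      (exists b, e1 = ELam b /\ e' = einst x b) \/
      (exists e2, e' = EApp e2 x /\ whred e1 e2)
  | EMu b => e' = einst (EMu b) b
  | _ => False
  end.
Proof.
  intros [R b|R b x]; destruct R as [|R y]; simpl; auto.
  - right; eexists; split; [reflexivity|constructor].
  - left; now exists b.
  - right; eexists; split; [reflexivity|constructor].
Qed.

Lemma whred_deterministic e : forall e1 e2, whred e e1 -> whred e e2 -> e1 = e2.
Proof.
  induction e as [c|a|b IH|f IHf x IHx|b IH]; intros e1 e2 H1 H2;
    apply whred_inv in H1, H2; try contradiction; try congruence.
  destruct H1 as [(b1 & -> & ->)|(f1 & -> & H1)],
    H2 as [(b2 & E & ->)|(f2 & -> & H2)]; subst.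
  - congruence.
  - now apply whred_inv in H2.
  - now apply whred_inv in H1.
  - f_equal; now apply IHf.
Qed.

Definition wh_acc : evidence C -> Prop := Acc (fun e' e => whred e e').

Lemma wh_acc_terminating e : wh_acc e -> wh_terminating e.
Proof.
  induction 1 as [e _ IH]; intros (s & <- & Hs).
  apply (IH (s 1) (Hs 0)); exists (fun n => s (S n)); auto.
Qed.

(** By determinism [e'] is the only reduct of [e]. *)
Lemma wh_acc_expand e e' : whred e e' -> wh_acc e' -> wh_acc e.
Proof.
  intros H H'; constructor; intros e'' H''.
  now rewrite (whred_deterministic _ _ _ H'' H).
Qed.

Lemma wh_acc_app_inv e x : wh_acc (EApp e x) -> wh_acc e.
Proof.
  intros H; remember (EApp e x) as f eqn:E; revert e E.
  induction H as [f _ IH]; intros e ->; constructor; intros e' He.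
  eapply IH; [apply whred_app; exact He|reflexivity].
Qed.

Definition wh_acc_apps e : Prop := forall es, wh_acc (eapps e es).

Lemma wh_acc_apps_expand e e' :
  whred e e' -> wh_acc_apps e' -> wh_acc_apps e.
Proof.
  intros H H' es; exact (wh_acc_expand _ _ (whred_eapps es _ _ H) (H' es)).
Qed.

(** Both hypotheses survive application to an argument, so no spine over such a head ever contains a
    weak head redex. *)
Lemma neutral_wh_acc_apps e :
  (forall e', ~ whred e e') -> (forall b, e <> ELam b) -> wh_acc_apps e.
Proof.
  intros Hr Hl es; revert e Hr Hl.
  induction es as [|x es IH]; intros e Hr Hl; simpl.
  - constructor; intros e' H; now destruct (Hr e').
  - apply IH; [|easy].
    intros e' H; apply whred_inv in H.
    destruct H as [(b & E & _)|(e2 & _ & H)]; [now apply (Hl b)|now apply (Hr e2)].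
Qed.

Lemma var_wh_acc_apps a : wh_acc_apps (EVar a).
Proof. apply neutral_wh_acc_apps; [exact (fun _ => whred_inv _ _)|easy]. Qed.

Lemma const_wh_acc_apps c : wh_acc_apps (EConst c).
Proof. apply neutral_wh_acc_apps; [exact (fun _ => whred_inv _ _)|easy]. Qed.

(** Each argument is consumed by one outer abstraction, and the contractum has the same shape with
    one abstraction fewer. If the arguments run out first, an abstraction remains, which is weak
    head normal; otherwise a constant is left at the head. *)
Lemma HNF_wh_acc_apps e : HNF e -> wh_acc_apps e.
Proof.
  intros (k & c & es & ->); revert es.
  induction k as [|k IH]; intros es args.
  (* The arguments inside the normal form and the supplied ones merge into a single spine over
     [c]. *)
  - unfold elams, eapps; simpl; rewrite <- fold_left_app.
    apply const_wh_acc_apps.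
  - destruct args as [|x args].
    + constructor; intros e' H; now apply whred_inv in H.
    + refine (wh_acc_expand _ _ (whred_eapps args _ _ (wh_beta Hole _ x)) _).
      change (wh_acc (eapps (einst x (elams k (eapps (EConst c) es))) args)).
      destruct (esubst_const_hnf c es k (scons x EVar)) as [es' E].
      unfold einst; rewrite E; apply IH.
Qed.

End Termination.

(** * Reducibility and the fundamental lemma *)

Section Reducibility.

Context {K P C : Type}.
Implicit Types (F : formula K P) (e : evidence C) (Phi : ctx K P C).

Fixpoint reducible F e : Prop :=
  match F with
  | Atom _ _ => wh_acc e
  | All F => reducible F e
  | Imp F F' => forall x, reducible F x -> reducible F' (EApp e x)
  end.

(** First-order substitution alters only the terms inside atoms, which reducibility ignores. *)
Lemma reducible_fsubst F : forall s e,
  reducible (fsubst s F) e <-> reducible F e.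
Proof.
  induction F as [p ts|F IH|F IH F' IH']; simpl; intros s e; [easy|apply IH|].
  split; intros H x Hx; apply (IH' s), H, (IH s), Hx.
Qed.

Lemma wh_acc_apps_reducible F : forall e, wh_acc_apps e -> reducible F e.
Proof.
  induction F as [p ts|F IH|F _ F' IH']; simpl; intros e H.
  - exact (H nil).
  - now apply IH.
  - intros x _; apply IH'; intros es; exact (H (x :: es)).
Qed.

Lemma reducible_wh_acc F : forall e, reducible F e -> wh_acc e.
Proof.
  induction F as [p ts|F IH|F _ F' IH']; simpl; intros e H; auto.
  (* Any variable would do as argument, being reducible at every formula. *)
  apply wh_acc_app_inv with (EVar 0), IH', H, wh_acc_apps_reducible,
    var_wh_acc_apps.
Qed.

Lemma reducible_expand F : forall e e',
  whred e e' -> reducible F e' -> reducible F e.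
Proof.
  induction F as [p ts|F IH|F _ F' IH']; simpl; intros e e' He H.
  - now apply wh_acc_expand with e'.
  - now apply IH with e'.
  - intros x Hx; apply IH' with (EApp e' x); [now apply whred_app|auto].
Qed.

Definition reducible_subst Phi (s : nat -> evidence C) : Prop :=
  forall a F, In (EVar a, F) Phi -> reducible F (s a).

Lemma reducible_subst_ext Phi F s x :
  reducible_subst Phi s -> reducible F x ->
  reducible_subst (ctx_ext Phi F) (scons x s).
Proof.
  intros Hs Hx a G [[= <- <-]|H]; [exact Hx|].
  apply in_map_iff in H; destruct H as ([d G'] & [= E <-] & Hd).
  (* Shifting preserves the head constructor, so an entry that shifts to a variable was a
     variable. *)
  destruct d; try discriminate; injection E as <-; now apply Hs.
Qed.

Lemma reducible_subst_fshift Phi s :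
  reducible_subst Phi s -> reducible_subst (ctx_fshift Phi) s.
Proof.
  intros Hs a G H.
  apply in_map_iff in H; destruct H as ([d G'] & [= -> <-] & Hd).
  now apply reducible_fsubst, Hs.
Qed.

Lemma typing_reducible Phi e F : typing Phi e F ->
  forall s, reducible_subst Phi s -> reducible F (esubst s e).
Proof.
  induction 1 as [Phi c F Hc|Phi a F Ha|Phi e1 e2 F' F _ IH1 _ IH2
    |Phi e F' F _ IH|Phi e F _ IH|Phi e F t _ IH|Phi e F _ _ Hnf];
    intros s Hs; simpl.
  - apply wh_acc_apps_reducible, const_wh_acc_apps.
  - now apply Hs.
  - exact (IH2 s Hs _ (IH1 s Hs)).
  - intros x Hx.
    apply (reducible_expand _ _ _ (wh_beta Hole _ x)); simpl.
    fold (up s); rewrite einst_esubst_up.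
    now apply IH, reducible_subst_ext.
  - now apply IH, reducible_subst_fshift.
  - apply reducible_fsubst; exact (IH s Hs).
  - apply wh_acc_apps_reducible.
    apply (wh_acc_apps_expand _ _ (wh_mu Hole _)).
    (* The body undergoes two substitutions, [s] lifted under the binder and then the unfolding;
       each preserves head normal forms. *)
    now apply HNF_wh_acc_apps, HNF_esubst, HNF_esubst.
Qed.

End Reducibility.

Theorem theorem5 (K P C : Type) (Phi : ctx K P C) (e : evidence C)
  (F : formula K P) (He : typing Phi e F) : wh_terminating e.
Proof.
  apply wh_acc_terminating, (reducible_wh_acc F).
  (* The fundamental lemma is used at the identity substitution. *)
  rewrite <- (esubst_id e EVar) by reflexivity.
  apply (typing_reducible _ _ _ He).
  intros a G _; apply wh_acc_apps_reducible, var_wh_acc_apps.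
Qed.
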